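(* Let $f$ be a real-valued symmetric function on $\{1,2,\dots\}^2$ and let $TI_f$ be the associated degree-based topological index. For $n\ge 3$ and $i\in\{1,2\}$ let $M_f(n,i)$ denote the maximum of $TI_f$ over all polyomino chains with $n$ squares whose last link is $L_n=i$. Then for all $n\ge 4$ and $i\in\{1,2\}$, $$M_f(n,i)=\max\{M_f(n-1,1)+g_f(1,i),\; M_f(n-1,2)+g_f(2,i)\}.$$
   Context: Polyomino chains (restricted model). For $n\ge 2$, a polyomino chain with $n$ squares is a sequence of closed unit squares $S_1,\dots,S_n$ in the plane with $S_1=[0,1]\times[0,1]$, $S_2=[1,2]\times[0,1]$, and for $k\ge 3$, $S_k=S_{k-1}+v_k$, where $v_2=(1,0)$ and each $v_k\in\{(1,0),(0,-1)\}$ satisfies $v_k=v_{k-1}$ if $L_k=1$ (link of type 1: direction preserved) and $v_k\neq v_{k-1}$ if $L_k=2$ (link of type 2: direction changes). So each new square is attached to the right of or below the previous one, and for $n\ge 3$ the chain is determined by its link vector $(L_3,\dots,L_n)\in\{1,2\}^{n-2}$; it is denoted $PC(L_3,\dots,L_n)$, while $PC_2$ denotes the chain with two squares. Each chain is regarded as the graph whose vertices are the corners of the squares and whose edges are the sides of the squares (a shared side is a single edge). $d_u$ denotes the degree of vertex $u$. For a real-valued symmetric $f$ on positive integers, $TI_f(G)=\sum_{uv\in E(G)} f(d_u,d_v)$. Define: $g_f(1,1)=3f(3,3)$; $g_f(1,2)=3f(3,4)+f(2,4)+f(2,3)-2f(3,3)$; $g_f(2,1)=f(3,4)-f(2,4)+f(2,3)+2f(3,3)$;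 $g_f(2,2)=f(4,4)+2f(2,4)$. *)

(* Defs.v *)
From HB Require Import structures.
From mathcomp Require Import all_boot all_order all_algebra.
From mathcomp Require Import reals.

Set Implicit Arguments.
Unset Strict Implicit.
Unset Printing Implicit Defensive.

Import Order.TTheory GRing.Theory Num.Theory.
Local Open Scope ring_scope.

Section DegreeBasedIndex.
Variables (V : eqType) (R : realType).

(* A finite simple graph given by the list of its edges, where each undirected
   edge occurs exactly once, in one of its two orientations. *)
Implicit Type E : seq (V * V).

Definition degree E (u : V) : nat :=
  count (fun e => (e.1 == u) || (e.2 == u)) E.

Definition TI (f : nat -> nat -> R) E : R :=
  \sum_(e <- E) f (degree E e.1) (degree E e.2).

End DegreeBasedIndex.

Variant link := link1 | link2.

Definition bool_of_link (l : link) : bool := if l is link1 then false else true.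
Definition link_of_bool (b : bool) : link := if b then link2 else link1.
Lemma bool_of_linkK : cancel bool_of_link link_of_bool. Proof. by case. Qed.
HB.instance Definition _ := Equality.copy link (can_type bool_of_linkK).
HB.instance Definition _ := Choice.copy link (can_type bool_of_linkK).
HB.instance Definition _ := Countable.copy link (can_type bool_of_linkK).
HB.instance Definition _ := Finite.copy link (can_type bool_of_linkK).

Definition point : Type := (int * int)%type.

Definition right_step : point := (1, 0).
Definition down_step : point := (0, -1).

(* v_k from v_(k-1) and L_k *)
Definition next_step (v : point) (l : link) : point :=
  match l with
  | link1 => v
  | link2 => if v == right_step then down_step else right_step
  end.

(* [:: v_2; v_3; ...; v_n] for L = [:: L_3; ...; L_n] *)
Definition steps (L : seq link) : seq point :=
  right_step :: scanl next_step right_step L.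

(* The squares S_1, ..., S_n, each given by its lower-left corner. *)
Definition squares (L : seq link) : seq point :=
  (0, 0) :: scanl +%R (0, 0) (steps L).

(* Every side is oriented from left to right or from bottom to top, so that a
   side shared by two squares is the same pair for both. *)
Definition sides (s : point) : seq (point * point) :=
  let a := s in
  let b := s + (1, 0) in
  let c := s + (0, 1) in
  let d := s + (1, 1) in
  [:: (a, b); (c, d); (a, c); (b, d)].

(* The edges of PC(L_3, ..., L_n); PC [::] is PC_2. *)
Definition PC (L : seq link) : seq (point * point) :=
  undup (flatten [seq sides s | s <- squares L]).

(* Only meaningful for 3 <= n, when L is nonempty and so has a last link. *)
Definition last_link (L : seq link) : link := last link1 L.

Definition M (R : realType) (f : nat -> nat -> R) (n : nat) (i : link) : R :=
  let best : (n - 2).-tuple link :=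
    [arg max_(L > nseq_tuple (n - 2) i | last_link L == i) TI f (PC L)]%O in
  TI f (PC best).

Lemma M_max (R : realType) (f : nat -> nat -> R) (n : nat) (i : link) :
  (3 <= n)%N ->
  (exists L : (n - 2).-tuple link, last_link L = i /\ TI f (PC L) = M f n i) /\
  (forall L : (n - 2).-tuple link, last_link L = i -> TI f (PC L) <= M f n i).
Proof.
move=> n3; rewrite /M; case: Order.TotalTheory.arg_maxP => /= [|L /eqP Li maxL].
  rewrite /last_link; have: (0 < n - 2)%N by rewrite subn_gt0.
  by case: (n - 2)%N => // k _; elim: k.
by split=> [|L' L'i]; [exists L | apply: maxL; apply/eqP].
Qed.

Definition g (R : realType) (f : nat -> nat -> R) (i j : link) : R :=
  match i, j with
  | link1, link1 => 3 * f 3%N 3%N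
  | link1, link2 => 3 * f 3%N 4%N + f 2%N 4%N + f 2%N 3%N - 2 * f 3%N 3%N
  | link2, link1 => f 3%N 4%N - f 2%N 4%N + f 2%N 3%N + 2 * f 3%N 3%N
  | link2, link2 => f 4%N 4%N + 2 * f 2%N 4%N
  end.

(* Main.v *)
Require Import Defs.
From mathcomp Require Import all_boot all_order all_algebra.
From mathcomp Require Import reals.
From mathcomp Require Import zify lra.
Import Order.TTheory GRing.Theory Num.Theory.
Local Open Scope ring_scope.

(** Let the level of a point [(x, y)] be [x - y].  It grows by one along each
    step of a chain, and every edge joins consecutive levels, so the change of
    the index when a square is attached is determined by that square and the
    three before it.  Translating the fourth square from the end to the origin,
    the edge set becomes a part [F] of nonpositive level, at whose vertices the
    last square changes no degree, followed by an explicit list which depends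
    only on three steps.  Hence lengthening a chain whose last link is [a] by a
    link [b] adds exactly [g f a b] to the index, and the recursion follows by
    splitting off the last link of an optimal chain. *)

(** * Invariance of degrees and of the index *)

Section Graphs.
Variables (R : realType) (f : nat -> nat -> R).

Lemma degree_cat {V : eqType} (E E' : seq (V * V)) (u : V) :
  degree (E ++ E') u = (degree E u + degree E' u)%N.
Proof. exact: count_cat. Qed.

Lemma TI_perm (V : eqType) (E E' : seq (V * V)) :
  perm_eq E E' -> TI f E = TI f E'.
Proof.
move=> EE'; rewrite /TI (perm_big _ EE'); apply: eq_bigr => e _.
by rewrite /degree !(permP EE').
Qed.

Lemma TI_map_inj (V W : eqType) (h : V -> W) (E : seq (V * V)) :
  injective h -> TI f [seq (h e.1, h e.2) | e <- E] = TI f E.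
Proof.
move=> h_inj.
have deg u : degree [seq (h e.1, h e.2) | e <- E] (h u) = degree E u.
  by rewrite /degree count_map; apply: eq_count => e /=; rewrite !(inj_eq h_inj).
by rewrite /TI big_map; apply: eq_bigr => e _; rewrite !deg.
Qed.

End Graphs.

Lemma perm_undup_cat {T : eqType} (s t : seq T) :
  uniq t -> perm_eq (undup (s ++ t)) (undup s ++ [seq x <- t | x \notin s]).
Proof.
move=> t_uniq; apply: uniq_perm; first exact: undup_uniq.
  rewrite cat_uniq undup_uniq filter_uniq // andbT /=.
  by apply/hasPn => x; rewrite mem_filter mem_undup => /andP[].
move=> x; rewrite mem_undup !mem_cat mem_filter mem_undup.
by case: (x \in s).
Qed.

(** * Levels of lattice points and translations *)

Definition level (p : point) : int := p.1 - p.2.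

Definition low (F : seq (point * point)) : bool :=
  all (fun e => (level e.1 <= 0) && (level e.2 <= 0)) F.

Definition high (k : int) (F : seq (point * point)) : bool :=
  all (fun e => (k <= level e.1) && (k <= level e.2)) F.

(** One endpoint of positive level already keeps an edge out of a [low] list. [high 1] would be too
    strong: the upper left corner of a square at level 1 has level 0. *)
Definition meets_high (F : seq (point * point)) : bool :=
  all (fun e => (0 < level e.1) || (0 < level e.2)) F.

Definition translate (s : point) (e : point * point) : point * point :=
  (e.1 + s, e.2 + s).

Lemma translate_inj (s : point) : injective (translate s).
Proof.
move=> [a b] [c d] E; congr (_, _).
  exact: (@addIr _ s _ _ (congr1 fst E)).
exact: (@addIr _ s _ _ (congr1 snd E)).
Qed.

Lemma TI_translate (R : realType) (f : nat -> nat -> R) (s : point)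
    (E : seq (point * point)) :
  TI f (map (translate s) E) = TI f E.
Proof. exact: (TI_map_inj _ _ _ _ _ _ (@addIr _ s)). Qed.

Lemma translateD (s t : point) (E : seq (point * point)) :
  map (translate (s + t)) E = map (translate s) (map (translate t) E).
Proof.
by rewrite -map_comp; apply: eq_map => e; rewrite /translate /= -!addrA (addrC t).
Qed.

Lemma sidesD (s t : point) : sides (s + t) = map (translate s) (sides t).
Proof.
have h u : s + t + u = t + u + s by rewrite -addrA addrC.
by rewrite /sides !h (addrC s t).
Qed.

Lemma sides_uniq (s : point) : uniq (sides s).
Proof. by rewrite -[s]addr0 sidesD (map_inj_uniq (translate_inj s)). Qed.

Lemma degree_low {F : seq (point * point)} {u : point} :
  low F -> 0 < level u -> degree F u = 0%N.
Proof.
move=> lowF u_gt0; apply/eqP; rewrite -leqn0 leqNgt -has_count; apply/hasPn=> e.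
move=> /(allP lowF) /andP[e1 e2]; apply/negP => /orP[] /eqP eu.
  by move: e1; rewrite eu leNgt u_gt0.
by move: e2; rewrite eu leNgt u_gt0.
Qed.

Lemma degree_high {k : int} {F : seq (point * point)} {u : point} :
  high k F -> level u < k -> degree F u = 0%N.
Proof.
move=> highF u_lt; apply/eqP; rewrite -leqn0 leqNgt -has_count; apply/hasPn=> e.
move=> /(allP highF) /andP[e1 e2]; apply/negP => /orP[] /eqP eu.
  by move: e1; rewrite eu leNgt u_lt.
by move: e2; rewrite eu leNgt u_lt.
Qed.

(** * Chains described by steps instead of links *)

Definition walk (vs : seq point) : seq point := (0, 0) :: scanl +%R (0, 0) vs.

Definition walk_end (vs : seq point) : point := foldl +%R (0, 0) vs.

Definition chain (vs : seq point) : seq (point * point) :=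
  undup (flatten [seq sides s | s <- walk vs]).

Lemma walk_end_rcons (vs : seq point) (v : point) :
  walk_end (rcons vs v) = walk_end vs + v.
Proof. by rewrite /walk_end -cats1 foldl_cat. Qed.

Lemma walk_rcons (vs : seq point) (v : point) :
  walk (rcons vs v) = rcons (walk vs) (walk_end (rcons vs v)).
Proof. by rewrite /walk scanl_rcons. Qed.

Definition attach (C : seq (point * point)) (q : point) : seq (point * point) :=
  C ++ [seq e <- sides q | e \notin C].

(** Every side of the new square reaches positive level, so none lies in [F]. Only the explicit list
    [C] has to be searched for the shared side, which makes attaching a square computable. *)
Lemma chain_attach (vs : seq point) (s p v : point) (F C : seq (point * point)) :
  low F -> walk_end vs = s + p -> meets_high (sides (p + v)) ->
  perm_eq (chain vs) (map (translate s) (F ++ C)) ->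
  perm_eq (chain (rcons vs v)) (map (translate s) (F ++ attach C (p + v))).
Proof.
move=> lowF vs_end pv_high vsE.
rewrite /chain walk_rcons walk_end_rcons vs_end map_rcons flatten_rcons.
apply: perm_trans (perm_undup_cat _ _ _) _; first exact: sides_uniq.
rewrite /attach catA map_cat; apply: perm_cat => //.
rewrite -addrA (sidesD s) filter_map.
rewrite (@eq_in_filter _ _ (fun e => e \notin C)) // => e e_pv.
rewrite -[LHS]/(translate s e \notin flatten [seq sides t | t <- walk vs]).
rewrite -(mem_undup (flatten _)) (perm_mem vsE) (mem_map (translate_inj s)).
rewrite mem_cat negb_or; suff -> : e \notin F by [].
apply/negP => /(allP lowF) /andP[e1 e2].
by move/(allP pv_high): e_pv; rewrite !ltNge e1 e2.
Qed.

(** * The last square of a chain *)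

Definition is_step (v : point) : bool := (v == right_step) || (v == down_step).

(* The two sides of the square at the origin of highest level; the next square
   shares exactly one of them. *)
Definition cap : seq (point * point) := [:: ((0, 0), (1, 0)); ((1, 0), (1, 1))].

(* The side of the square at [v] lying neither in [cap] nor in its translate. *)
Definition mid_edge (v : point) : point * point :=
  if v == right_step then ((1, 1), (2, 1)) else ((0, -1), (0, 0)).

Lemma attach_cap (v : point) : is_step v ->
  perm_eq (attach cap v) (cap ++ mid_edge v :: map (translate v) cap).
Proof. by case/orP => /eqP ->; vm_compute. Qed.

Lemma chain_cap (vs : seq point) : all is_step vs ->
  exists2 F, low F & perm_eq (chain vs) (map (translate (walk_end vs)) (F ++ cap)).
Proof.
elim/last_ind: vs => [_|vs v IH].
  (* These are the two sides of the unit square outside [cap]. *)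
  by exists [:: ((0, 1), (1, 1)); ((0, 0), (0, 1))]; vm_compute.
rewrite all_rcons => /andP[v_step /IH[F lowF vsE]].
(* Moving the origin to the new square lowers levels by one. The vertices of [cap] and [mid_edge v]
   have level at most 1, so both can join the low part. *)
exists (map (translate (- v)) (F ++ cap ++ [:: mid_edge v])).
  rewrite /low all_map all_cat; apply/andP; split.
    apply: sub_all lowF => -[[a b] [c d]]; rewrite /level /=.
    by case/orP: v_step => /eqP -> /=; lia.
  by case/orP: v_step => /eqP ->; vm_compute.
rewrite walk_end_rcons translateD map_cat -translateD subrr.
have -> E : map (translate 0) E = E.
  by rewrite -[RHS]map_id; apply: eq_map => -[a b]; rewrite /translate /= !addr0.
have := chain_attach vs (walk_end vs) 0 v F cap lowF.
rewrite addr0 add0r => /(_ erefl) attachE.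
apply: perm_trans (attachE _ vsE) _.
  by case/orP: v_step => /eqP ->; vm_compute.
apply: perm_map; rewrite -!catA perm_cat2l /=.
exact: attach_cap.
Qed.

(** * The change of the index when a square is attached *)

Lemma TI_attach (R : realType) (f : nat -> nat -> R)
    (F C N : seq (point * point)) :
  low F -> high 1 N ->
  TI f (F ++ C ++ N) - TI f (F ++ C) =
  \sum_(e <- C ++ N) f (degree (F ++ C ++ N) e.1) (degree (F ++ C ++ N) e.2) -
  \sum_(e <- C) f (degree (F ++ C) e.1) (degree (F ++ C) e.2).
Proof.
move=> lowF highN; rewrite /TI [X in X - _]big_cat [X in _ - X]big_cat.
(* [N] adds no degree at nonpositive levels, so the terms of [F] cancel. *)
have -> : \sum_(e <- F) f (degree (F ++ C ++ N) e.1) (degree (F ++ C ++ N) e.2)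
        = \sum_(e <- F) f (degree (F ++ C) e.1) (degree (F ++ C) e.2).
  rewrite !big_seq; apply: eq_bigr => e /(allP lowF) /andP[e1 e2].
  by rewrite catA !(degree_cat (F ++ C)) !(degree_high highN) ?addn0 //;
    apply: le_lt_trans (ltr01).
by rewrite addrAC opprD addNKr addrC.
Qed.

(** Branching on the level lets [vm_compute] reach a numeral at positive levels; elsewhere the
    unknown [d u] stays symbolic. *)
Definition degree_above (d : point -> nat) (C : seq (point * point)) (u : point) :=
  if 0 < level u then degree C u else (d u + degree C u)%N.

Lemma sum_degree_above (R : realType) (f : nat -> nat -> R)
    (F C : seq (point * point)) : low F ->
  \sum_(e <- C) f (degree (F ++ C) e.1) (degree (F ++ C) e.2) =
  \sum_(p <- [seq (degree_above (degree F) C e.1, degree_above (degree F) C e.2)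
              | e <- C]) f p.1 p.2.
Proof.
move=> lowF; have deg u : degree (F ++ C) u = degree_above (degree F) C u.
  rewrite degree_cat /degree_above; case: ifP => // u_gt0.
  by rewrite (degree_low lowF u_gt0).
by rewrite big_map; apply: eq_bigr => e _; rewrite !deg.
Qed.

(** The new square, at level 3, changes degrees only at levels at least 2. The affected edges thus
    have both ends at level at least 1, where [F] contributes nothing, and eight explicit cases
    remain. *)
Lemma TI_attach_square (R : realType) (f : nat -> nat -> R)
    (f_sym : forall a b : nat, (0 < a)%N -> (0 < b)%N -> f a b = f b a)
    (F : seq (point * point)) (v : point) (a b : link) :
  low F -> is_step v ->
  let w := next_step v a in
  let C := attach (attach cap v) (v + w) in
  TI f (F ++ attach C (v + w + next_step w b)) = TI f (F ++ C) + g f a b.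
Proof.
move=> lowF v_step w C.
apply/eqP; rewrite [X in _ == X]addrC -subr_eq; apply/eqP.
rewrite {1}/attach TI_attach //; last first.
  by rewrite /C /w {C w}; case/orP: v_step => /eqP ->; case: a b => -[]; vm_compute.
rewrite !sum_degree_above // -/(attach C (v + w + next_step w b)) /C /w {C w}.
(* Sides are oriented by position, so degree pairs occur in both orders. *)
have f32 := f_sym 3%N 2%N isT isT.
have f42 := f_sym 4%N 2%N isT isT.
have f43 := f_sym 4%N 3%N isT isT.
by case/orP: v_step => /eqP ->; case: a b => -[];
  (* Evaluates the degree pairs before and after attachment. Terms still containing [degree F] are
     equal in both sums, and [lra] cancels them. *)
  (do 2! (match goal with |- context [\sum_(p <- map ?h ?l) _] =>
    let l' := eval vm_compute in (map h l) in
    change (map h l) with l' end));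
  rewrite !big_cons !big_nil /= ?f32 ?f42 ?f43; lra.
Qed.

(** * From steps to links, and the recursion for the maximum *)

Definition last_step (L : seq link) : point := foldl next_step right_step L.

Lemma last_step_rcons (L : seq link) (l : link) :
  last_step (rcons L l) = next_step (last_step L) l.
Proof. by rewrite /last_step -cats1 foldl_cat. Qed.

Lemma steps_rcons (L : seq link) (l : link) :
  steps (rcons L l) = rcons (steps L) (next_step (last_step L) l).
Proof. by rewrite -last_step_rcons /steps scanl_rcons. Qed.

Lemma next_step_is_step (v : point) (l : link) :
  is_step v -> is_step (next_step v l).
Proof. by case/orP => /eqP ->; case: l. Qed.

Lemma stepsE (L : seq link) :
  is_step (last_step L) /\
  exists2 vs, all is_step vs & steps L = rcons vs (last_step L).
Proof.
elim/last_ind: L => [|L l [step_L [vs vs_step LE]]].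
  by split=> //; exists [::].
rewrite last_step_rcons; split; first exact: next_step_is_step.
exists (steps L); last exact: steps_rcons.
by rewrite LE all_rcons step_L.
Qed.

Lemma TI_PC_rcons (R : realType) (f : nat -> nat -> R)
    (f_sym : forall a b : nat, (0 < a)%N -> (0 < b)%N -> f a b = f b a)
    (L : seq link) (a b : link) :
  TI f (PC (rcons (rcons L a) b)) = TI f (PC (rcons L a)) + g f a b.
Proof.
have [v_step [vs vs_step LE]] := stepsE L.
have [F lowF vsE] := chain_cap vs vs_step.
(* The square at [s] is the fourth from the end; [v], [w] and [u] lead to the last three. *)
set v := last_step L in v_step LE; set s := walk_end vs in vsE.
set w := next_step v a; set u := next_step w b.
set C1 := attach cap v; set C2 := attach C1 (v + w).
have perm1 : perm_eq (chain (rcons vs v)) (map (translate s) (F ++ C1)).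
  have := chain_attach vs s 0 v F cap lowF; rewrite addr0 add0r; apply=> //.
  by case/orP: v_step => /eqP ->; vm_compute.
have end1 : walk_end (rcons vs v) = s + v by rewrite walk_end_rcons.
have perm2 :
    perm_eq (chain (rcons (rcons vs v) w)) (map (translate s) (F ++ C2)).
  apply: (chain_attach _ _ _ _ _ _ lowF end1 _ perm1).
  by rewrite /w; case/orP: v_step => /eqP ->; case: (a); vm_compute.
have end2 : walk_end (rcons (rcons vs v) w) = s + (v + w).
  by rewrite walk_end_rcons end1 addrA.
have perm3 : perm_eq (chain (rcons (rcons (rcons vs v) w) u))
                     (map (translate s) (F ++ attach C2 (v + w + u))).
  apply: (chain_attach _ _ _ _ _ _ lowF end2 _ perm2).
  by rewrite /u /w; case/orP: v_step => /eqP ->; case: (a) (b) => -[]; vm_compute.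
have PC2 : PC (rcons L a) = chain (rcons (rcons vs v) w).
  by rewrite -[LHS]/(chain (steps _)) steps_rcons LE.
have PC3 : PC (rcons (rcons L a) b) = chain (rcons (rcons (rcons vs v) w) u).
  by rewrite -[LHS]/(chain (steps _)) !steps_rcons last_step_rcons LE.
rewrite PC2 PC3 (TI_perm _ _ _ _ _ perm2) (TI_perm _ _ _ _ _ perm3).
rewrite !TI_translate; exact: TI_attach_square.
Qed.

Lemma M_succ (R : realType) (f : nat -> nat -> R)
    (f_sym : forall a b : nat, (0 < a)%N -> (0 < b)%N -> f a b = f b a)
    (m : nat) (i : link) :
  M f m.+4 i = Num.max (M f m.+3 link1 + g f link1 i)
                       (M f m.+3 link2 + g f link2 i).
Proof.
have M_ge (n : nat) (l : link) (L : seq link) : size L = n.+1 -> last_link L = l ->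
    TI f (PC L) <= M f n.+3 l.
  move=> /eqP sizeL lastL.
  exact: (proj2 (M_max f (n := n.+3) l isT) (Tuple sizeL)).
have M_ex (n : nat) (l : link) :
    exists2 L, size L = n & M f n.+3 l = TI f (PC (rcons L l)).
  have [[[L /= sizeL] [lastL <-]] _] := M_max f (n := n.+3) l isT.
  move: lastL; rewrite /last_link /=.
  case/lastP: L sizeL => [//|L x]; rewrite size_rcons last_rcons => /eqP[sizeL] <-.
  by exists L; rewrite ?sizeL.
(* Lower bound: append [i] to an optimal shorter chain ending in [a]. *)
have ge_succ a : M f m.+3 a + g f a i <= M f m.+4 i.
  have [L sizeL ME] := M_ex m a; rewrite ME -(TI_PC_rcons _ _ f_sym).
  apply: M_ge; first by rewrite !size_rcons sizeL.
  exact: last_rcons.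
apply/eqP; rewrite eq_le ge_max !ge_succ !andbT.
(* Upper bound: drop the last link of an optimal chain. With at least four squares there is a link
   [a] before it. *)
have [L] := M_ex m.+1 i; move: (M f m.+4 i) => Mi.
case/lastP: L => [|L a]; first by discriminate.
rewrite size_rcons => -[sizeL] ->; rewrite (TI_PC_rcons _ _ f_sym).
apply: (@le_trans _ _ (M f m.+3 a + g f a i)); last first.
  by rewrite le_max; case: (a); rewrite lexx ?orbT.
rewrite lerD2r; apply: M_ge; first by rewrite size_rcons sizeL.
exact: last_rcons.
Qed.

Theorem theorem1 (R : realType) (f : nat -> nat -> R)
    (f_sym : forall a b : nat, (0 < a)%N -> (0 < b)%N -> f a b = f b a)
    (n : nat) (n_ge4 : (4 <= n)%N) (i : link) :
  M f n i = Num.max (M f (n - 1) link1 + g f link1 i)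
                    (M f (n - 1) link2 + g f link2 i).
Proof.
case: n n_ge4 => [|[|[|[|m]]]] // _; rewrite subn1; exact: M_succ.
Qed.
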